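(* Let $K$ be a field with $\mathrm{char}(K)\neq 2$ and let $E$ be an elliptic curve over $K$. Then $E(K)$ contains a subgroup isomorphic to $\mathbb{Z}/8\mathbb{Z}\oplus\mathbb{Z}/4\mathbb{Z}$ if and only if $K$ contains an element $\mathbf{i}$ with $\mathbf{i}^2=-1$ and there exist $c,d\in K\setminus\{0,\pm1,\pm1\pm\sqrt2,\pm\sqrt{-1}\}$ such that $$c-\frac1c=\mathbf{i}\left(d-\frac1d\right)$$ and $E$ is isomorphic (over $K$) to the elliptic curve $$\mathcal{E}_{4,c}: y^2=\left[x+\left(\frac{c-\frac1c}{2}\right)^4\right](x+1)x.$$
   Context: The excluded set $\{0,\pm1,\pm1\pm\sqrt2,\pm\sqrt{-1}\}$ means all elements of $K$ equal to $0,\pm1$, or to a square root of $-1$, or to $\pm1\pm s$ with $s^2=2$ (those that exist in $K$). *)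

(* Defs.v *)
From HB Require Import structures.
From mathcomp Require Import all_boot all_order all_algebra.

Set Implicit Arguments.
Unset Strict Implicit.
Unset Printing Implicit Defensive.

Import GRing.Theory.
Local Open Scope ring_scope.

(* Elliptic curves are given by general Weierstrass equations
     y^2 + a1 x y + a3 y = x^3 + a2 x^2 + a4 x + a6
   with nonzero discriminant. *)
Record weierstrass (K : Type) := Weierstrass
  { wa1 : K; wa2 : K; wa3 : K; wa4 : K; wa6 : K }.

Section EllipticCurves.

Variable K : fieldType.
Implicit Types (W : weierstrass K).

Definition b2 W : K := wa1 W ^+ 2 + 4%:R * wa2 W.
Definition b4 W : K := 2%:R * wa4 W + wa1 W * wa3 W.
Definition b6 W : K := wa3 W ^+ 2 + 4%:R * wa6 W.
Definition b8 W : K :=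
  wa1 W ^+ 2 * wa6 W + 4%:R * wa2 W * wa6 W - wa1 W * wa3 W * wa4 W
  + wa2 W * wa3 W ^+ 2 - wa4 W ^+ 2.

Definition discriminant W : K :=
  - b2 W ^+ 2 * b8 W - 8%:R * b4 W ^+ 3 - 27%:R * b6 W ^+ 2
  + 9%:R * b2 W * b4 W * b6 W.

Definition elliptic W : Prop := discriminant W != 0.

(* [None] is the point at infinity. *)
Definition point : Type := option (K * K).

Definition on_curve W (P : point) : Prop :=
  if P is Some (x, y) then
    y ^+ 2 + wa1 W * x * y + wa3 W * y
    = x ^+ 3 + wa2 W * x ^+ 2 + wa4 W * x + wa6 W
  else True.

Definition ec_opp W (P : point) : point :=
  if P is Some (x, y) then Some (x, - y - wa1 W * x - wa3 W) else None.

(* Chord-and-tangent addition; only meaningful for points of the curve. *)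
Definition ec_add W (P Q : point) : point :=
  match P, Q with
  | None, _ => Q
  | _, None => P
  | Some (x1, y1), Some (x2, y2) =>
      if (x1 == x2) && (y2 == - y1 - wa1 W * x1 - wa3 W) then None else
      let l :=
        if x1 == x2 then
          (3%:R * x1 ^+ 2 + 2%:R * wa2 W * x1 + wa4 W - wa1 W * y1)
          / (2%:R * y1 + wa1 W * x1 + wa3 W)
        else (y2 - y1) / (x2 - x1) in
      let x3 := l ^+ 2 + wa1 W * l - wa2 W - x1 - x2 in
      Some (x3, - (l * (x3 - x1) + y1) - wa1 W * x3 - wa3 W)
  end.

Definition is_subgroup W (H : point -> Prop) : Prop :=
  [/\ forall P, H P -> on_curve W P,
      H None,
      forall P Q, H P -> H Q -> H (ec_add W P Q)
    & forall P, H P -> H (ec_opp W P)].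

Definition group_iso_to (G : zmodType) W (H : point -> Prop) : Prop :=
  exists phi : G -> point,
    [/\ forall g h, phi (g + h) = ec_add W (phi g) (phi h),
        injective phi
      & forall P, H P <-> exists g, phi g = P].

Definition has_subgroup_iso_to (G : zmodType) W : Prop :=
  exists H, is_subgroup W H /\ group_iso_to G W H.

(* The Weierstrass equation obtained from W by the substitution
     x = u^2 x' + r,  y = u^3 y' + u^2 s x' + t. *)
Definition change_variables (u r s t : K) W : weierstrass K :=
  let: Weierstrass a1 a2 a3 a4 a6 := W in
  Weierstrass
    ((a1 + 2%:R * s) / u)
    ((a2 - s * a1 + 3%:R * r - s ^+ 2) / u ^+ 2)
    ((a3 + r * a1 + 2%:R * t) / u ^+ 3)
    ((a4 - s * a3 + 2%:R * r * a2 - (t + r * s) * a1 + 3%:R * r ^+ 2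
      - 2%:R * s * t) / u ^+ 4)
    ((a6 + r * a4 + r ^+ 2 * a2 + r ^+ 3 - t * a3 - t ^+ 2 - r * t * a1)
      / u ^+ 6).

(* The isomorphisms over K between elliptic curves in Weierstrass form (fixing
   the point at infinity) are the admissible changes of variables over K. *)
Definition isomorphic W W' : Prop :=
  exists u r s t : K, u != 0 /\ W' = change_variables u r s t W.

(* y^2 = (x + A) (x + B) (x + C) *)
Definition cubic_curve (A B C : K) : weierstrass K :=
  Weierstrass 0 (A + B + C) 0 (A * B + A * C + B * C) (A * B * C).

Definition E4 (c : K) : weierstrass K :=
  cubic_curve (((c - c^-1) / 2%:R) ^+ 4) 1 0.

(* c lies in {0, +-1, +-1 +- sqrt 2, +- sqrt (-1)} *)
Definition excluded (c : K) : Prop :=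
  [\/ c = 0, c = 1 \/ c = -1,
      (exists s : K, s ^+ 2 = 2%:R /\
         [\/ c = 1 + s, c = 1 - s, c = -1 + s | c = -1 - s])
    | c ^+ 2 = -1].

End EllipticCurves.

(* Main.v *)
(* The theorem reduces to halving points.  On y^2 = (x - e1) (x - e2) (x - e3) the
   numbers x(2 Q) - ei are squares, and conversely square roots ri of x0 - ei give
   a half of the point of abscissa x0.  Let R and S be independent of orders 8
   and 4; moving 4 R to (0, 0) and rescaling, the fact that 4 R, 2 R and 2 S can
   be halved says that the roots are 0, -1, -a^4 with 1 + a^2, 1 - a^2 and -1
   squares.  The conics s^2 = 1 + a^2 and t^2 = 1 + (a / i)^2 are parametrized by
   c = a + s and d = a / i + t, since then c^-1 = s - a and d^-1 = t - a / i.

   To see that the explicit points R and S generate a subgroup one needs the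
   associativity of the chord-and-tangent law.  A point P is sent to the ideal
   I_P of functions vanishing at P in the coordinate ring K[x, y] / (y^2 - f x);
   lines show that I_P I_Q and I_(P + Q) are in the same ideal class, and P is
   determined by the class of I_P because I_P is not principal for P affine. *)
From HB Require Import structures.
From mathcomp Require Import all_boot all_order all_algebra.
From mathcomp Require Import zify ring.
Require Import Defs.

Set Implicit Arguments.
Unset Strict Implicit.
Unset Printing Implicit Defensive.
Import GRing.Theory.
Local Open Scope ring_scope.

(** * The coordinate ring and its ideal classes *)

(* [(p, q)] stands for [p + q y], where [y ^ 2 = f x]. *)
Definition coord_ring (K : fieldType) (f : {poly K}) : Type :=
  ({poly K} * {poly K})%type.

HB.instance Definition _ (K : fieldType) (f : {poly K}) :=
  GRing.Zmodule.on (coord_ring f).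

Section CoordRing.
Variables (K : fieldType) (f : {poly K}).
Local Notation A := (coord_ring f).

Definition coord_one : A := (1, 0).
Definition coord_mul (z w : A) : A :=
  (z.1 * w.1 + z.2 * w.2 * f, z.1 * w.2 + z.2 * w.1).

Fact coord_mulA : associative coord_mul.
Proof. by move=> z w v; congr pair => /=; ring. Qed.
Fact coord_mulC : commutative coord_mul.
Proof. by move=> z w; congr pair => /=; ring. Qed.
Fact coord_mul1 : left_id coord_one coord_mul.
Proof. by case=> p q; congr pair => /=; ring. Qed.
Fact coord_mulDl : left_distributive coord_mul +%R.
Proof. by move=> z w v; congr pair => /=; ring. Qed.
Fact coord_oner_neq0 : coord_one != 0.
Proof. by apply/eqP=> -[] /eqP; rewrite oner_eq0. Qed.

HB.instance Definition _ := GRing.Zmodule_isComNzRing.Build A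
  coord_mulA coord_mulC coord_mul1 coord_mulDl coord_oner_neq0.

Lemma coordM (z w : A) :
  z * w = (z.1 * w.1 + z.2 * w.2 * f, z.1 * w.2 + z.2 * w.1).
Proof. by []. Qed.
Lemma coordD (z w : A) : z + w = (z.1 + w.1, z.2 + w.2).
Proof. by []. Qed.

(** The product of p + q y with its conjugate p - q y. *)
Definition coord_norm (z : A) : {poly K} := z.1 ^+ 2 - z.2 ^+ 2 * f.

Lemma coord_normM (z w : A) :
  coord_norm (z * w) = coord_norm z * coord_norm w.
Proof. by rewrite /coord_norm coordM /=; ring. Qed.

Hypothesis size_f : size f = 4%N.

Let f_neq0 : f != 0. Proof. by rewrite -size_poly_eq0 size_f. Qed.

(* The two terms of the norm have degrees of different parity. *)
Lemma size_coord_norm (z : A) :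
  size (coord_norm z) = maxn (size (z.1 ^+ 2)) (size (z.2 ^+ 2 * f)).
Proof.
case: z => p q; rewrite /coord_norm /=.
have [->|q0] := eqVneq q 0; first by rewrite expr0n mul0r subr0 size_poly0 maxn0.
have sq : size (q ^+ 2 * f) = ((size q).*2).+2.
  rewrite size_mul ?expf_neq0 // size_f expr2 size_mul //.
  move: q0; rewrite -size_poly_gt0; move: (size q) => n n0; lia.
have [->|p0] := eqVneq p 0.
  by rewrite expr0n sub0r size_polyN size_poly0 max0n.
have sp : size (p ^+ 2) = ((size p).*2).-1 by rewrite expr2 size_mul // addnn.
have odd_sp : odd (size (p ^+ 2)).
  rewrite sp; move: p0; rewrite -size_poly_gt0.
  by case: (size p) => // n _; rewrite doubleS /= odd_double.
case: (ltngtP (size (p ^+ 2)) (size (q ^+ 2 * f))) => [lt|lt|e].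
- by rewrite addrC size_polyDl size_polyN ?(maxn_idPr (ltnW lt)).
- by rewrite size_polyDl ?size_polyN ?(maxn_idPl (ltnW lt)).
- by move: odd_sp; rewrite e sq /= odd_double.
Qed.

(** A nonzero second component contributes a term of degree at least 3, which cannot cancel. *)
Lemma coord_norm_small (z : A) : (size (coord_norm z) <= 3)%N -> z.2 = 0.
Proof.
rewrite size_coord_norm geq_max => /andP[_]; apply: contraTeq => q0.
have q20 := expf_neq0 2 q0; rewrite -ltnNge (size_mul q20 f_neq0) size_f.
by move: q20; rewrite -size_poly_gt0; move: (size _) => n; lia.
Qed.

Lemma coord_norm_eq0 (z : A) : coord_norm z = 0 -> z = 0.
Proof.
move=> nz; have z2 : z.2 = 0 by apply: coord_norm_small; rewrite nz size_poly0.
move: nz; rewrite /coord_norm z2 expr0n mul0r subr0 => /eqP.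
by rewrite sqrf_eq0 => /eqP z1; case: z z1 z2 => p q /= -> ->.
Qed.

(** The norm is multiplicative and kills only 0, so the coordinate ring inherits being a domain from
    [{poly K}]. *)
Lemma coord_mulf_neq0 (z w : A) : z != 0 -> w != 0 -> z * w != 0.
Proof.
move=> z0 w0; apply/eqP=> /(congr1 coord_norm); rewrite coord_normM.
rewrite [RHS]/coord_norm /= expr0n mul0r subr0 => /eqP; rewrite mulf_eq0.
by case/orP=> /eqP /coord_norm_eq0 /eqP; apply/negP.
Qed.

Lemma coord_mulfI (z : A) : z != 0 -> injective ( *%R z).
Proof.
move=> z0 w v /eqP; rewrite -subr_eq0 -mulrBr => /eqP e; apply/eqP.
by rewrite -subr_eq0; apply/negP => /negP /(coord_mulf_neq0 z0); rewrite e eqxx.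
Qed.

End CoordRing.

Section IdealClasses.
Variable R : comNzRingType.
Implicit Types I J L M : R -> Prop.

Definition is_ideal I : Prop :=
  [/\ I 0, forall a b, I a -> I b -> I (a + b) & forall a b, I b -> I (a * b)].

(** Quantifying over all ideals [M] that contain the products replaces finite sums by an induction
    principle. *)
Definition ideal_mul I J : R -> Prop := fun z =>
  forall M, is_ideal M -> (forall a b, I a -> J b -> M (a * b)) -> M z.

Lemma ideal_mul_is_ideal I J : is_ideal (ideal_mul I J).
Proof.
split=> [M [] //|a b Ia Ib M iM MIJ|a b Ib M iM MIJ].
  by case: (iM) => _ + _; apply; [apply: Ia|apply: Ib].
by case: (iM) => _ _; apply; apply: Ib.
Qed.

Lemma mem_ideal_mul I J a b : I a -> J b -> ideal_mul I J (a * b).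
Proof. by move=> Ia Jb M _; apply. Qed.

Lemma ideal_mulC I J z : ideal_mul I J z -> ideal_mul J I z.
Proof.
by apply=> [|a b Ia Jb]; [apply: ideal_mul_is_ideal|rewrite mulrC; apply: mem_ideal_mul].
Qed.

Lemma ideal_mulA I J L z :
  ideal_mul (ideal_mul I J) L z -> ideal_mul I (ideal_mul J L) z.
Proof.
have [M0 MD MM] := ideal_mul_is_ideal I (ideal_mul J L).
(* For fixed [c], the elements whose product with [c] lies in the target form an ideal, so products
   from [I] and [J] suffice. *)
apply=> // a c IJa Lc; apply: (IJa (fun a => ideal_mul I (ideal_mul J L) (a * c))).
  split=> [|u v ? ?|u v ?]; rewrite ?mul0r ?mulrDl -?mulrA //; first exact: MD.
  exact: MM.
by move=> i j Ii Jj; rewrite -mulrA; do 2!apply: mem_ideal_mul => //.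
Qed.

(** Equality of g I and h J, that is, of ideal classes, without a fraction field. *)
Definition ideal_eqv I J : Prop :=
  exists g h, [/\ g != 0, h != 0,
    forall z, I z -> exists2 w, J w & g * z = h * w
  & forall w, J w -> exists2 z, I z & g * z = h * w].

Lemma ideal_eqv_sym I J : ideal_eqv I J -> ideal_eqv J I.
Proof.
case=> g [h [g0 h0 IJ JI]]; exists h, g; split=> // z.
  by case/JI=> w; exists w.
by case/IJ=> w; exists w.
Qed.

Lemma eq_ideal_eqv I J : (forall z, I z <-> J z) -> ideal_eqv I J.
Proof.
move=> eqIJ; exists 1, 1; split; rewrite ?oner_neq0 // => z.
  by move/eqIJ; exists z.
by move/eqIJ; exists z.
Qed.

Lemma ideal_eqv_mulr I I' J :
  ideal_eqv I I' -> ideal_eqv (ideal_mul I J) (ideal_mul I' J).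
Proof.
have aux L L' g h : (forall z, L z -> exists2 w, L' w & g * z = h * w) ->
    forall z, ideal_mul L J z -> exists2 w, ideal_mul L' J w & g * z = h * w.
  move=> LL' z LJz.
  apply: (LJz (fun z => exists2 w, ideal_mul L' J w & g * z = h * w)).
    have [M0 MD MM] := ideal_mul_is_ideal L' J.
    split=> [|a b [u Lu eu] [v Lv ev]|a b [v Lv ev]].
    - by exists 0; rewrite // !mulr0.
    - by exists (u + v); [apply: MD|rewrite !mulrDr eu ev].
    - by exists (a * v); [apply: MM|rewrite !(mulrCA _ a) ev].
  move=> a b /LL' [w L'w e] Jb; exists (w * b); first exact: mem_ideal_mul.
  by rewrite !mulrA e.
case=> g [h [g0 h0 II' I'I]]; exists g, h; split=> //; first exact: aux.
have I'I' w : I' w -> exists2 z, I z & h * w = g * z.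
  by case/I'I=> z; exists z.
by move=> w /(aux _ _ _ _ I'I') [z]; exists z.
Qed.

Hypothesis mul_neq0 : forall z w : R, z != 0 -> w != 0 -> z * w != 0.

Lemma ideal_eqv_trans J I L : ideal_eqv I J -> ideal_eqv J L -> ideal_eqv I L.
Proof.
case=> g [h [g0 h0 IJ JI]] [g' [h' [g'0 h'0 JL LJ]]].
exists (g' * g), (h * h'); split; try exact: mul_neq0.
  move=> z /IJ[w /JL[v Lv e'] e]; exists v => //.
  by rewrite -!mulrA -e' e mulrCA.
move=> v /LJ[w /JI[z Iz e] e']; exists z => //.
by rewrite -!mulrA -e' e mulrCA.
Qed.

End IdealClasses.

(** * The group law on y^2 = x^3 + a2 x^2 + a4 x + a6 *)

Section GroupLaw.
Variables (K : fieldType) (a2 a4 a6 : K).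
Hypothesis char_neq2 : 2%N \notin [pchar K].

Let two_neq0 : 2%:R != 0 :> K.
Proof. by move: char_neq2; rewrite inE. Qed.

Local Notation W := (Weierstrass 0 a2 0 a4 a6).

Definition cubic : {poly K} := 'X^3 + a2 *: 'X^2 + a4 *: 'X + a6%:P.
Local Notation A := (coord_ring cubic).

Lemma size_cubic : size cubic = 4%N.
Proof.
rewrite /cubic -!addrA size_polyDl size_polyXn //.
rewrite (leq_ltn_trans (size_polyD _ _)) // gtn_max.
rewrite (leq_ltn_trans (size_scale_leq _ _)) ?size_polyXn //=.
rewrite (leq_ltn_trans (size_polyD _ _)) // gtn_max.
rewrite (leq_ltn_trans (size_scale_leq _ _)) ?size_polyX //=.
by rewrite (leq_ltn_trans (size_polyC_leq1 _)).
Qed.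

Lemma cubic_horner x : cubic.[x] = x ^+ 3 + a2 * x ^+ 2 + a4 * x + a6.
Proof. by rewrite /cubic !hornerE. Qed.

Lemma on_curve_short x y : on_curve W (Some (x, y)) <-> y ^+ 2 = cubic.[x].
Proof. by rewrite cubic_horner /= !mul0r !addr0. Qed.

Lemma ec_opp_short x y : ec_opp W (Some (x, y)) = Some (x, - y).
Proof. by rewrite /= mul0r !subr0. Qed.

Lemma on_curve_opp P : on_curve W P -> on_curve W (ec_opp W P).
Proof.
by case: P => [[x y]|] //; rewrite ec_opp_short !on_curve_short sqrrN.
Qed.

(* [l] is the slope of the chord, or of the tangent; the coefficients are
   expressed in a way that covers both cases. *)
Variant ec_add_spec (x1 y1 x2 y2 : K) : point K -> Prop :=
| AddOpp of x2 = x1 & y2 = - y1 : ec_add_spec x1 y1 x2 y2 None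
| AddChord l of y2 = y1 + l * (x2 - x1)
    & a4 = l * (y1 + y2) - (x1 ^+ 2 + x1 * x2 + x2 ^+ 2) - a2 * (x1 + x2)
    & (x1 == x2) ==> (y1 != 0) :
  ec_add_spec x1 y1 x2 y2 (Some (l ^+ 2 - a2 - x1 - x2,
     - (l * (l ^+ 2 - a2 - x1 - x2 - x1) + y1))).

Lemma ec_addP x1 y1 x2 y2 :
  on_curve W (Some (x1, y1)) -> on_curve W (Some (x2, y2)) ->
  ec_add_spec x1 y1 x2 y2 (ec_add W (Some (x1, y1)) (Some (x2, y2))).
Proof.
rewrite !on_curve_short !cubic_horner => e1 e2.
rewrite /ec_add /= !(mul0r, subr0, addr0).
have [ex|nx] := eqVneq x1 x2; last first.
  rewrite /=; have nx' : x2 - x1 != 0 by rewrite subr_eq0 eq_sym.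
  apply: AddChord; rewrite ?(negPf nx) //; first by field.
  (* The formula for [a4] is the difference of the two curve equations divided by [x2 - x1]. *)
  apply: (mulIf nx'); apply/eqP; rewrite -subr_eq0; apply/eqP.
  transitivity ((y1 ^+ 2 - (x1 ^+ 3 + a2 * x1 ^+ 2 + a4 * x1 + a6))
     - (y2 ^+ 2 - (x2 ^+ 3 + a2 * x2 ^+ 2 + a4 * x2 + a6))); last first.
    by rewrite e1 e2 !subrr.
  by field.
rewrite -ex in e2 *; have [ey|ny] := eqVneq y2 (- y1) => /=; first exact: AddOpp.
have ey : y2 = y1.
  have /eqP : (y2 - y1) * (y2 + y1) = 0 by rewrite -subr_sqr e1 e2 subrr.
  by rewrite mulf_eq0 subr_eq0 addr_eq0 (negPf ny) orbF => /eqP.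
rewrite ey in ny *.
have y10 : y1 != 0 by apply: contra ny => /eqP ->; rewrite oppr0.
have dy : 2%:R * y1 != 0 by rewrite mulf_neq0.
apply: AddChord; rewrite ?y10 ?implybT ?subrr ?mulr0 ?addr0 //.
by field; rewrite y10 two_neq0.
Qed.

Lemma on_curve_add P Q :
  on_curve W P -> on_curve W Q -> on_curve W (ec_add W P Q).
Proof.
case: P Q => [[x1 y1]|] [[x2 y2]|] // cP cQ; case: (ec_addP cP cQ) => // l ey ea _.
move: cP; rewrite !on_curve_short !cubic_horner ea => cP.
apply/eqP; rewrite -subr_eq0; apply/eqP.
transitivity (y1 ^+ 2 - (x1 ^+ 3 + a2 * x1 ^+ 2 +
  (l * (y1 + y2) - (x1 ^+ 2 + x1 * x2 + x2 ^+ 2) - a2 * (x1 + x2)) * x1 + a6)).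
  by rewrite ey; ring.
by rewrite cP subrr.
Qed.

(** Nothing is required at infinity, so [None] gets the unit ideal, which represents the trivial
    class. *)
Definition vanish (P : point K) : A -> Prop := fun z =>
  if P is Some (x, y) then z.1.[x] + z.2.[x] * y = 0 else True.

Lemma vanish_ideal P : on_curve W P -> is_ideal (vanish P).
Proof.
case: P => [[x y]|] // /on_curve_short cP; split=> [|a b|a b]; rewrite /vanish.
- by rewrite !horner0 mul0r addr0.
- rewrite coordD /= !hornerD => ea eb; rewrite -[RHS]addr0 -{1}ea -eb; ring.
- rewrite coordM /= 2!hornerD !hornerM -cP => eb.
  transitivity ((a.1.[x] + a.2.[x] * y) * 0).
    by rewrite -eb; ring.
  by rewrite mulr0.
Qed.

Local Notation base p := ((p, 0) : A).
Local Notation xline x0 := (base ('X - x0%:P)).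
(* y - (l (x - x0) + y0) *)
Local Notation line l x0 y0 := (((- (l *: ('X - x0%:P) + y0%:P), 1) : A)).

(** Write z = (z1 + y z2) + z2 (Y - y), where X - x divides the first term. The slope is free, so
    that one chord can serve as generator at both of its points. *)
Lemma vanish_decomp l x y z : vanish (Some (x, y)) z ->
  exists a b : A, z = a * xline x + b * line l x y.
Proof.
move=> /= vz; have /factor_theorem [q eq] : root (z.1 + y *: z.2) x.
  by apply/rootP; rewrite !hornerE mulrC.
exists (q + l *: z.2, 0), (z.2, 0); rewrite !coordM coordD /=.
case: z vz q eq => z1 z2 /= _ q eq; congr pair; last by rewrite -?mul_polyC; ring.
rewrite -[z1](addrK (y *: z2)) eq -!mul_polyC; ring.
Qed.

Lemma vanish_xline x y : vanish (Some (x, y)) (xline x).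
Proof. by rewrite /= !hornerE subrr ?mul0r ?addr0. Qed.

Lemma vanish_line l x y : vanish (Some (x, y)) (line l x y).
Proof. by rewrite /= !hornerE subrr ?mulr0 ?add0r addNr. Qed.


Lemma line_through l x0 y0 x1 y1 :
  y1 = y0 + l * (x1 - x0) -> line l x1 y1 = line l x0 y0.
Proof. by move=> ->; congr pair; rewrite -!mul_polyC; ring. Qed.

(** If the line is Y = m(X), the left side is (Y - m)(Y + m) = f - m^2, a monic cubic whose roots
    are the abscissas of the three intersections. *)
Lemma line_mul_conj l x1 y1 x2 :
  on_curve W (Some (x1, y1)) ->
  a4 = l * (y1 + (y1 + l * (x2 - x1))) - (x1 ^+ 2 + x1 * x2 + x2 ^+ 2) - a2 * (x1 + x2) ->
  line l x1 y1 * line (- l) x1 (- y1) =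
  xline x1 * xline x2 * xline (l ^+ 2 - a2 - x1 - x2).
Proof.
move=> /on_curve_short; rewrite cubic_horner => e6 e4.
have {}e6 : a6 = y1 ^+ 2 - x1 ^+ 3 - a2 * x1 ^+ 2 - a4 * x1 by rewrite e6; ring.
rewrite !coordM /=; congr pair; last by rewrite -!mul_polyC; ring.
by rewrite /cubic -!mul_polyC e6 e4; ring.
Qed.

Lemma ideal_scale (J : A -> Prop) c z : is_ideal J -> c != 0 ->
  J (base c%:P * z) -> J z.
Proof.
case=> _ _ JM c0 /(JM (base c^-1%:P)); rewrite mulrA [X in X * z]coordM /=.
by rewrite !(mul0r, mulr0, addr0) -polyCM mulVf // mul1r.
Qed.

Hypothesis ell : elliptic W.

(** At a double root, solving for [a4] and [a6] makes the discriminant vanish identically. *)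
Lemma cubic_deriv_neq0 x : cubic.[x] = 0 -> 3%:R * x ^+ 2 + 2%:R * a2 * x + a4 != 0.
Proof.
rewrite cubic_horner => e6; apply: contra ell => /eqP e4; apply/eqP.
have {}e4 : a4 = - (3%:R * x ^+ 2 + 2%:R * a2 * x) by rewrite -[LHS]subr0 -e4; ring.
have {}e6 : a6 = - (x ^+ 3 + a2 * x ^+ 2 + a4 * x) by rewrite -[LHS]subr0 -e6; ring.
by rewrite /discriminant /b2 /b4 /b6 /b8 /= e6 e4; ring.
Qed.

Lemma xline_neq0 x : xline x != 0.
Proof. by apply/eqP=> -[] /eqP; rewrite polyXsubC_eq0. Qed.

Lemma line_neq0 l x y : line l x y != 0.
Proof. by apply/eqP=> -[] _ /eqP; rewrite oner_eq0. Qed.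

(** The product is the principal ideal of X - x. One inclusion holds because (Y - y)(Y + y) = f(X) -
    f(x) is divisible by X - x. *)
Lemma vanish_mul_opp P : on_curve W P ->
  ideal_eqv (ideal_mul (vanish P) (vanish (ec_opp W P))) (vanish None).
Proof.
case: P => [[x y]|] cP; last first.
  by apply: eq_ideal_eqv => z; split=> // _; rewrite -[z]mul1r; apply: mem_ideal_mul.
rewrite ec_opp_short; set J := ideal_mul _ _.
have iJ : is_ideal J by apply: ideal_mul_is_ideal.
have [_ JD JM] := iJ.
(* The quotient of f(X) - f(x) by X - x; its value at x is f'(x). *)
pose g : {poly K} := 'X ^+ 2 + x%:P * 'X + x%:P ^+ 2 + a2%:P * ('X + x%:P) + a4%:P.
have ell_g : line 0 x y * line 0 x (- y) = xline x * base g.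
  move: cP => /on_curve_short; rewrite cubic_horner => e6.
  have {}e6 : a6 = y ^+ 2 - x ^+ 3 - a2 * x ^+ 2 - a4 * x by rewrite e6; ring.
  rewrite !coordM /= /g; congr pair; last by rewrite -?mul_polyC; ring.
  by rewrite /cubic -!mul_polyC e6; ring.
exists 1, (xline x); split; rewrite ?oner_neq0 ?xline_neq0 //.
  move=> z Jz; apply: (Jz (fun z => exists2 w, vanish None w & 1 * z = xline x * w)).
    split=> [|a b [u _]|a b [v _]].
    - by exists 0; rewrite // !mulr0.
    - by rewrite !mul1r => -> [v _ ->]; exists (u + v); rewrite // mulrDr.
    - by rewrite !mul1r => ->; exists (a * v); rewrite // mulrCA.
  move=> _ _ /(vanish_decomp 0)[a1 [a0 ->]] /(vanish_decomp 0)[b1 [b0 ->]].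
  exists (a1 * (b1 * xline x + b0 * line 0 x (- y)) + b1 * (a0 * line 0 x y)
      + a0 * b0 * base g) => //.
  transitivity (xline x * (a1 * (b1 * xline x + b0 * line 0 x (- y))
      + b1 * (a0 * line 0 x y)) + a0 * b0 * (line 0 x y * line 0 x (- y))).
    by ring.
  by rewrite ell_g; ring.
move=> w _; exists (xline x * w); last by rewrite mul1r.
rewrite mulrC; apply: (JM).
have Jyy : J (xline x * base g).
  by rewrite -ell_g; apply: mem_ideal_mul; apply: vanish_line.
have Jxx : J (xline x * xline x) by apply: mem_ideal_mul; apply: vanish_xline.
have [y0|y0] := eqVneq y 0; last first.
  have Jx1 : J (xline x * line 0 x (- y)).
    by apply: mem_ideal_mul; [apply: vanish_xline|apply: vanish_line].
  have Jx2 : J (xline x * line 0 x y).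
    rewrite mulrC; apply: mem_ideal_mul; [apply: vanish_line|exact: vanish_xline].
  (* (X - x)(Y + y) and (X - x)(Y - y) differ by 2 y (X - x). *)
  apply: (@ideal_scale J (2%:R * y)) => //; first by rewrite mulf_neq0.
  have := JD _ _ Jx1 (JM (- 1) _ Jx2); congr J.
  by rewrite !coordM coordD /=; congr pair; rewrite -!mul_polyC; ring.
(* When y = 0, both (X - x) g and (X - x)^2 lie in [J], and g is congruent to the nonzero constant
   f'(x) modulo X - x. *)
have := cP => /on_curve_short; rewrite y0 expr0n /= => /esym /cubic_deriv_neq0 d0.
apply: (ideal_scale iJ d0).
have := JD _ _ Jyy (JM (base (- ('X + 2%:R *: x%:P + a2%:P))) _ Jxx); congr J.
by rewrite !coordM coordD /= /g; congr pair; rewrite -!mul_polyC; ring.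
Qed.

(** The line L through P and Q has divisor P + Q + S, with S opposite to the sum, while X - x3
    vanishes at S and at the sum. Hence X - x3 times I_P I_Q is L times the ideal of the sum. *)
Lemma vanish_mul_add P Q : on_curve W P -> on_curve W Q ->
  ideal_eqv (ideal_mul (vanish P) (vanish Q)) (vanish (ec_add W P Q)).
Proof.
case: P => [[x1 y1]|]; last first.
  move=> _ cQ /=; apply: eq_ideal_eqv => z; split=> [|Qz].
    apply; first exact: vanish_ideal.
    by move=> a b _ Qb; case: (vanish_ideal cQ) => _ _; apply.
  by rewrite -[z]mul1r; apply: mem_ideal_mul.
case: Q => [[x2 y2]|]; last first.
  move=> cP _ /=; apply: eq_ideal_eqv => z; split=> [|Pz].
    apply; first exact: (vanish_ideal cP).
    by move=> a b Pa _; rewrite mulrC; case: (vanish_ideal cP) => _ _; apply.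
  by rewrite -[z]mulr1; apply: mem_ideal_mul.
move=> cP cQ; move: (on_curve_add cP cQ).
case: (ec_addP cP cQ) => [ex ey _|l ey e4 tangent].
  by rewrite ex ey -ec_opp_short; apply: vanish_mul_opp.
have LL : line l x2 y2 = line l x1 y1 by apply: line_through.
rewrite ey in e4; have := line_mul_conj cP e4.
set x3 := l ^+ 2 - a2 - x1 - x2.
set L := line l x1 y1; set L' := line (- l) x1 (- y1) => eLL'.
set y3 := - _ => cS.
(* L passes through the opposite of the sum, so the conjugate line passes through the sum. *)
have L'3 : line (- l) x3 y3 = L' by apply: line_through; rewrite /y3 /x3; ring.
have [V0 VD VM] := vanish_ideal cS; set J := ideal_mul _ _.
have iJ : is_ideal J by apply: ideal_mul_is_ideal.
have [_ JD JM] := iJ.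
have JxL : J (xline x1 * L).
  by rewrite /L -LL; apply: mem_ideal_mul; [apply: vanish_xline|apply: vanish_line].
have JLx : J (L * xline x2).
  by apply: mem_ideal_mul; [apply: vanish_line|apply: vanish_xline].
have Jxx : J (xline x1 * xline x2) by apply: mem_ideal_mul; apply: vanish_xline.
have JLL : J (L * L).
  by rewrite /L -{2}LL; apply: mem_ideal_mul; apply: vanish_line.
(* For a chord, (X - x1) L - (X - x2) L = (x2 - x1) L. For a tangent, L L' is a multiple of (X -
   x1)(X - x2) and L' - L = 2 (l (X - x1) + y1), which yields 2 y1 L. *)
have JL : J L.
  have [ex|nx] := eqVneq x1 x2; last first.
    apply: (@ideal_scale J (x2 - x1)); rewrite // ?subr_eq0 1?eq_sym //.
    have := JD _ _ JxL (JM (- 1) _ JLx); congr J.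
    by rewrite !coordM coordD /=; congr pair; rewrite -!mul_polyC; ring.
  have y10 : y1 != 0 by move: tangent; rewrite ex eqxx.
  apply: (@ideal_scale J (2%:R * y1)) => //; first by rewrite mulf_neq0.
  have := JD _ _ (JD _ _ (JM (xline x3) _ Jxx) (JM (- 1) _ JLL))
    (JM (base (- (2%:R * l)%:P)) _ JxL); congr J.
  rewrite (mulrC (xline x3)) -eLL'.
  by rewrite !coordM !coordD /=; congr pair; rewrite -!mul_polyC; ring.
exists (xline x3), L; split; rewrite ?xline_neq0 ?line_neq0 //.
  move=> z Jz; pose V := vanish (Some (x3, y3)).
  apply: (Jz (fun z => exists2 w, V w & xline x3 * z = L * w)).
    split=> [|a b [u Vu eu] [v Vv ev]|a b [v Vv ev]].
    - by exists 0; rewrite // !mulr0.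
    - by exists (u + v); [apply: VD|rewrite !mulrDr eu ev].
    - by exists (a * v); [apply: VM|rewrite !(mulrCA _ a) ev].
  move=> _ _ /(vanish_decomp l)[a1 [a0 ->]] /(vanish_decomp l)[b1 [b0 ->]].
  rewrite LL -/L; exists (a1 * b1 * L'
    + (a1 * b0 * xline x1 + a0 * b1 * xline x2 + a0 * b0 * L) * xline x3).
    apply: VD; apply: VM; last exact: vanish_xline.
    by rewrite -L'3; apply: vanish_line.
  transitivity (a1 * b1 * (xline x1 * xline x2 * xline x3) + L *
    ((a1 * b0 * xline x1 + a0 * b1 * xline x2 + a0 * b0 * L) * xline x3)); first by ring.
  by rewrite -eLL'; ring.
move=> w /(vanish_decomp (- l))[a [b ->]]; rewrite L'3.
exists (a * L + b * (xline x1 * xline x2)); first by apply: JD; apply: JM.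
transitivity (L * a * xline x3 + b * (xline x1 * xline x2 * xline x3)); first by ring.
by rewrite -eLL'; ring.
Qed.

(* A generator of the ideal of a point [(x, y)] has norm dividing that of the
   function [X - x], hence of degree at most 2, so it is a polynomial in [X]
   vanishing at [x]; but such a polynomial does not divide [Y - y]. *)
Lemma vanish_principal P : on_curve W P ->
  ideal_eqv (vanish P) (vanish None) -> P = None.
Proof.
case: P => [[x y]|] // cP [g [h [g0 h0 PA AP]]].
have [k Pk ek] := AP 1 I.
have gen z : vanish (Some (x, y)) z -> exists w, z = k * w.
  case/PA=> w _ e; exists w; apply: (coord_mulfI size_cubic g0).
  by rewrite e -[h]mulr1 -ek mulrA.
have [v ev] := gen _ (vanish_xline x y).
have [w ew] := gen _ (vanish_line 0 x y).
have k2 : k.2 = 0.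
  apply: (coord_norm_small size_cubic).
  have := congr1 (@coord_norm _ _) ev; rewrite coord_normM => enorm.
  have : size (coord_norm (xline x)) = 3%N.
    by rewrite /coord_norm /= expr0n mul0r subr0 size_exp_XsubC.
  rewrite enorm => sz; rewrite -sz; apply: dvdp_leq; last exact: dvdp_mulr.
  by rewrite -size_poly_eq0 sz.
move: ew Pk; rewrite coordM /= k2 horner0 !mul0r !addr0.
case=> _ /(congr1 (horner^~ x)).
by rewrite hornerC hornerM => /eqP + k0; rewrite k0 mul0r oner_eq0.
Qed.

Let eqv_trans := ideal_eqv_trans (coord_mulf_neq0 size_cubic).

(** I_P I_(-Q) has the class of I_Q I_(-Q), which is trivial, so P - Q has a principal ideal and is
    [None]. *)
Lemma vanish_inj P Q : on_curve W P -> on_curve W Q ->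
  ideal_eqv (vanish P) (vanish Q) -> P = Q.
Proof.
move=> cP cQ ePQ; have cQ' := on_curve_opp cQ.
have : ec_add W P (ec_opp W Q) = None.
  apply: vanish_principal; first exact: on_curve_add.
  apply: eqv_trans (vanish_mul_opp cQ).
  apply: eqv_trans (ideal_eqv_sym (vanish_mul_add cP cQ')) _.
  exact: ideal_eqv_mulr.
case: P Q cP cQ {ePQ} cQ' => [[x1 y1]|] [[x2 y2]|] // cP cQ; rewrite ec_opp_short => cQ'.
by case: (ec_addP cP cQ') => // -> /oppr_inj ->.
Qed.

Lemma ec_addC P Q : on_curve W P -> on_curve W Q -> ec_add W P Q = ec_add W Q P.
Proof.
move=> cP cQ; apply: vanish_inj; try exact: on_curve_add.
apply: eqv_trans (vanish_mul_add cQ cP).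
apply: eqv_trans (ideal_eqv_sym (vanish_mul_add cP cQ)) _.
by apply: eq_ideal_eqv => z; split; apply: ideal_mulC.
Qed.

(** Both sides have the class of I_P I_Q I_S, which determines a point. *)
Lemma ec_addA P Q S : on_curve W P -> on_curve W Q -> on_curve W S ->
  ec_add W P (ec_add W Q S) = ec_add W (ec_add W P Q) S.
Proof.
move=> cP cQ cS.
have cPQ := on_curve_add cP cQ; have cQS := on_curve_add cQ cS.
apply: vanish_inj; try exact: on_curve_add.
rewrite (ec_addC cP cQS).
apply: eqv_trans (vanish_mul_add cPQ cS).
apply: eqv_trans (ideal_eqv_mulr _ (vanish_mul_add cP cQ)).
apply: eqv_trans (ideal_eqv_sym (vanish_mul_add cQS cP)) _.
apply: eqv_trans (ideal_eqv_mulr _ (ideal_eqv_sym (vanish_mul_add cQ cS))) _.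
apply: eq_ideal_eqv => z; split=> [|/ideal_mulA/ideal_mulC //].
by move=> /ideal_mulA/ideal_mulC/ideal_mulA/ideal_mulC.
Qed.

Lemma ec_addN P : on_curve W P -> ec_add W (ec_opp W P) P = None.
Proof.
case: P => [[x y]|] // cP; rewrite ec_opp_short /= eqxx mul0r !subr0 opprK eqxx.
by [].
Qed.

End GroupLaw.

(** * The abelian group of points *)

Definition on_curveb (K : fieldType) (a2 a4 a6 : K) : pred (option (K * K)) :=
  fun P => if P is Some (x, y) then y ^+ 2 == (cubic a2 a4 a6).[x] else true.

(** The hypotheses are parameters of the type because its group structure depends on them. *)
Definition ec_group (K : fieldType) (a2 a4 a6 : K)
    (char_neq2 : 2%N \notin [pchar K])
    (ell : elliptic (Weierstrass 0 a2 0 a4 a6)) : Type :=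
  {P : option (K * K) | on_curveb a2 a4 a6 P}.

HB.instance Definition _ K a2 a4 a6 c e :=
  SubChoice.copy (@ec_group K a2 a4 a6 c e)
    {P : option (K * K) | on_curveb a2 a4 a6 P}.

Section ECGroup.
Variables (K : fieldType) (a2 a4 a6 : K).
Hypotheses (char_neq2 : 2%N \notin [pchar K])
  (ell : elliptic (Weierstrass 0 a2 0 a4 a6)).
Local Notation W := (Weierstrass 0 a2 0 a4 a6).
Local Notation G := (ec_group char_neq2 ell).

Lemma on_curveE (P : point K) : on_curve W P <-> on_curveb a2 a4 a6 P.
Proof.
by case: P => [[x y]|] //; rewrite on_curve_short; split=> /eqP.
Qed.

Definition ec_of (P : point K) (cP : on_curve W P) : G :=
  exist _ P ((on_curveE P).1 cP).

Lemma ec_on_curve (P : G) : on_curve W (val P).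
Proof. exact/on_curveE/(valP P). Qed.

Definition ec_zero : G := @ec_of None I.
Definition ec_group_add (P Q : G) : G :=
  ec_of (on_curve_add char_neq2 (ec_on_curve P) (ec_on_curve Q)).
Definition ec_group_opp (P : G) : G := ec_of (on_curve_opp (ec_on_curve P)).

Fact ec_group_addA : associative ec_group_add.
Proof. by move=> P Q S; apply/val_inj/ec_addA => //; apply: ec_on_curve. Qed.
Fact ec_group_addC : commutative ec_group_add.
Proof. by move=> P Q; apply/val_inj/ec_addC => //; apply: ec_on_curve. Qed.
Fact ec_group_add0 : left_id ec_zero ec_group_add.
Proof. by move=> P; apply/val_inj. Qed.
Fact ec_group_addN : left_inverse ec_zero ec_group_opp ec_group_add.
Proof. by move=> P; apply/val_inj/ec_addN/ec_on_curve. Qed.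

HB.instance Definition _ := GRing.isZmodule.Build G
  ec_group_addA ec_group_addC ec_group_add0 ec_group_addN.

Lemma val_ec_add (P Q : G) : val (P + Q) = ec_add W (val P) (val Q).
Proof. by []. Qed.

Lemma val_ec_opp (P : G) : val (- P) = ec_opp W (val P).
Proof. by []. Qed.

Lemma has_subgroup_of_additive (V : zmodType) (f : V -> G) :
  {morph f : g h / g + h} -> injective f -> has_subgroup_iso_to V W.
Proof.
move=> fD f_inj; exists (fun P => exists g, val (f g) = P); split; last first.
  by exists (fun g => val (f g)); split=> // [g h|g h /val_inj/f_inj //]; rewrite fD.
have f0 : f 0 = 0 by apply: (addrI (f 0)); rewrite -fD !addr0.
split=> [_ [g <-]||_ _ [g <-] [h <-]|_ [g <-]].
- exact: ec_on_curve.
- by exists 0; rewrite f0.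
- by exists (g + h); rewrite fD.
- exists (- g); rewrite -val_ec_opp; congr val; apply/eqP.
  by rewrite -addr_eq0 -fD addNr f0.
Qed.

End ECGroup.

(** * Embeddings of Z/8 x Z/4 *)

Section Z8Z4.
Variables (V : zmodType) (R S : V).
Hypotheses (R8 : R *+ 8 = 0) (S4 : S *+ 4 = 0).

Definition z8z4_map (g : 'Z_8 * 'Z_4) : V := R *+ g.1 + S *+ g.2.

Lemma mulrn_modn (x : V) n m : x *+ n = 0 -> x *+ (m %% n) = x *+ m.
Proof. by move=> xn; rewrite {2}(divn_eq m n) mulrnDr mulnC mulrnA xn mul0rn add0r. Qed.

Lemma z8z4_mapD : {morph z8z4_map : g h / g + h}.
Proof.
move=> g h; rewrite /z8z4_map /= !mulrn_modn // !mulrnDr; exact: addrACA.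
Qed.

Hypotheses (R4_neq0 : R *+ 4 != 0) (S2_neq0 : S *+ 2 != 0)
  (R4S2 : R *+ 4 != S *+ 2).

Let mulrn_odd (T : V) n : T *+ 2 = 0 -> T *+ n = T *+ (odd n).
Proof. by move=> T2; rewrite -(mulrn_modn n T2) modn2. Qed.

(** Only parities matter, as [R *+ 4] and [S *+ 2] are killed by 2; the hypotheses exclude the three
    nontrivial combinations. *)
Let indep n m : R *+ (4 * n) + S *+ (2 * m) = 0 -> ~~ odd n /\ ~~ odd m.
Proof.
have R42 : R *+ 4 *+ 2 = 0 by rewrite -mulrnA.
have S22 : S *+ 2 *+ 2 = 0 by rewrite -mulrnA.
rewrite !mulrnA (mulrn_odd n R42) (mulrn_odd m S22).
case: (odd n) (odd m) => [] [] //=; rewrite ?mulr1n ?muln0 ?mulr0n ?muln1 ?addr0 ?add0r.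
- move/eqP; rewrite addr_eq0 => /eqP e; case/eqP: R4S2; rewrite e.
  by apply/eqP; rewrite eq_sym -addr_eq0 -mulrnDr S4.
- by move/eqP; rewrite (negPf R4_neq0).
- by move/eqP; rewrite (negPf S2_neq0).
Qed.

(** Binary digits are peeled off: a relation m R + n S = 0 is multiplied by 4, 2 and 1, and [indep]
    is applied each time, so 8 divides m and 4 divides n. *)
Lemma z8z4_map_inj : injective z8z4_map.
Proof.
suff ker g : z8z4_map g = 0 -> g = 0.
  move=> g h e; apply/eqP; rewrite -subr_eq0; apply/eqP/ker.
  by apply: (addIr (z8z4_map h)); rewrite -z8z4_mapD subrK add0r.
case: g => m n; rewrite /z8z4_map /= => e.
have [m0 _] : ~~ odd m /\ ~~ odd 0.
  apply: indep; rewrite muln0 mulr0n addr0; move: (congr1 (fun x => x *+ 4) e).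
  by rewrite mulrnDl mul0rn -!mulrnA (mulnC n) (mulrnA S) S4 mul0rn addr0 mulnC.
have [m1 n0] : ~~ odd m./2 /\ ~~ odd n.
  apply: indep; move: (congr1 (fun x => x *+ 2) e).
  rewrite mulrnDl mul0rn -!mulrnA; congr (R *+ _ + S *+ _ = _); lia.
have [m2 n1] : ~~ odd m./2./2 /\ ~~ odd n./2.
  apply: indep; rewrite -[RHS]e; congr (R *+ _ + S *+ _); lia.
have m8 : (m < 8)%N := ltn_ord m.
have n4 : (n < 4)%N := ltn_ord n.
congr pair; apply: val_inj => /=;
  move: (nat_of_ord m) (nat_of_ord n) m0 m1 m2 n0 n1 m8 n4 => {e}a b; lia.
Qed.

End Z8Z4.

(** * Changes of variables *)

Section ChangeVariables.
Variable K : fieldType.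
Implicit Types (W : weierstrass K) (u r s t : K) (P Q : point K).

(** The substitution solved for the new coordinates. *)
Definition change_point u r s t P : point K :=
  if P is Some (x, y) then
    Some ((x - r) / u ^+ 2, (y - s * (x - r) - t) / u ^+ 3)
  else None.

Lemma change_point_inj u r s t : u != 0 -> injective (change_point u r s t).
Proof.
move=> u0 [[x y]|] [[x' y']|] //= [].
move=> /(mulIf (invr_neq0 (expf_neq0 2 u0)))/addIr <-.
by move=> /(mulIf (invr_neq0 (expf_neq0 3 u0)))/addIr/addIr <-.
Qed.

Lemma on_curve_change u r s t W P : u != 0 -> on_curve W P ->
  on_curve (change_variables u r s t W) (change_point u r s t P).
Proof.
case: W P => a1 a2 a3 a4 a6 [[x y]|] //= u0 e.
have {}e : a6 = y ^+ 2 + a1 * x * y + a3 * y - (x ^+ 3 + a2 * x ^+ 2 + a4 * x).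
  by rewrite e; ring.
by rewrite e; field.
Qed.

Lemma ec_opp_change u r s t W P : u != 0 ->
  ec_opp (change_variables u r s t W) (change_point u r s t P) =
  change_point u r s t (ec_opp W P).
Proof.
by case: W P => a1 a2 a3 a4 a6 [[x y]|] //= u0; congr (Some (_, _)); field.
Qed.

Lemma ec_add_change u r s t W P Q : u != 0 -> on_curve W P -> on_curve W Q ->
  ec_add (change_variables u r s t W) (change_point u r s t P) (change_point u r s t Q) =
  change_point u r s t (ec_add W P Q).
Proof.
case: W P Q => a1 a2 a3 a4 a6 [[x1 y1]|] [[x2 y2]|] //= u0 e1 e2.
have ex : ((x1 - r) / u ^+ 2 == (x2 - r) / u ^+ 2) = (x1 == x2).
  by rewrite (inj_eq (mulIf (invr_neq0 (expf_neq0 2 u0)))) (inj_eq (addIr _)).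
rewrite ex; have [exx|nx] := eqVneq x1 x2 => /=; last first.
  have d : x2 - x1 != 0 by rewrite subr_eq0 eq_sym.
  by congr (Some (_, _)); field; rewrite u0 d.
rewrite -{x2}exx in e2 ex *.
set z := (X in (_ == X)).
have -> : z = ((- y1 - a1 * x1 - a3) - s * (x1 - r) - t) / u ^+ 3.
  by rewrite /z; field.
rewrite (inj_eq (mulIf (invr_neq0 (expf_neq0 3 u0)))) !(inj_eq (addIr _)).
have [//|ny] := eqVneq y2 _.
(* Points with equal abscissas are equal or opposite, so this is the tangent case. *)
have ey : y2 = y1.
  have /eqP : (y2 - y1) * (y2 + y1 + a1 * x1 + a3) = 0.
    transitivity ((y2 ^+ 2 + a1 * x1 * y2 + a3 * y2)
        - (y1 ^+ 2 + a1 * x1 * y1 + a3 * y1)).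
      by ring.
    by rewrite e1 e2 subrr.
  rewrite mulf_eq0 => /orP[|/eqP h]; first by rewrite subr_eq0 => /eqP.
  by case/eqP: ny; rewrite -[RHS]addr0 -h; ring.
have d : 2%:R * y1 + a1 * x1 + a3 != 0.
  by apply: contra ny => /eqP h; rewrite ey -[X in X == _]subr0 -h; apply/eqP; ring.
by congr (Some (_, _)); field; rewrite u0 d.
Qed.

Lemma change_variablesK u r s t W : u != 0 ->
  change_variables u^-1 (- r / u ^+ 2) (- s / u) ((r * s - t) / u ^+ 3)
    (change_variables u r s t W) = W.
Proof.
by case: W => a1 a2 a3 a4 a6 u0 /=; congr Weierstrass; field; rewrite u0 oner_neq0.
Qed.

Lemma isomorphic_sym W W' : isomorphic W W' -> isomorphic W' W.
Proof.
case=> u [r [s [t [u0 ->]]]].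
exists u^-1, (- r / u ^+ 2), (- s / u), ((r * s - t) / u ^+ 3).
by rewrite invr_neq0 // change_variablesK.
Qed.

Lemma isomorphic_trans W' W W'' :
  isomorphic W W' -> isomorphic W' W'' -> isomorphic W W''.
Proof.
case=> u [r [s [t [u0 ->]]]] [u' [r' [s' [t' [u'0 ->]]]]].
exists (u * u'), (r + u ^+ 2 * r'), (s + u * s'), (t + u ^+ 3 * t' + u ^+ 2 * s * r').
rewrite mulf_neq0 //; split=> //; case: W => a1 a2 a3 a4 a6 /=.
by congr Weierstrass; field; rewrite u0 u'0.
Qed.

Lemma has_subgroup_isomorphic (G : zmodType) W W' : isomorphic W W' ->
  has_subgroup_iso_to G W -> has_subgroup_iso_to G W'.
Proof.
case=> u [r [s [t [u0 ->]]]] [H [[Hon H0 HD HN] [phi [phiD phi_inj Hphi]]]].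
have phiH g : H (phi g) by apply/Hphi; exists g.
exists (fun P => exists2 Q, H Q & change_point u r s t Q = P); split.
  split=> [_ [Q HQ <-]||_ _ [P HP <-] [Q HQ <-]|_ [P HP <-]].
  - by apply: on_curve_change => //; apply: Hon.
  - by exists None.
  - exists (ec_add W P Q); first exact: HD.
    by rewrite ec_add_change //; apply: Hon.
  - by exists (ec_opp W P); [apply: HN|rewrite ec_opp_change].
exists (fun g => change_point u r s t (phi g)); split.
- by move=> g h; rewrite phiD ec_add_change //; apply: Hon.
- by move=> g h /(change_point_inj u0)/phi_inj.
move=> P; split=> [[_ /Hphi[g <-] <-]|[g <-]]; first by exists g.
by exists (phi g).
Qed.

End ChangeVariables.

(** * Halving points *)

Section Halving.
Variables (K : fieldType) (char_neq2 : 2%N \notin [pchar K]).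

Let two_neq0 : 2%:R != 0 :> K.
Proof. by move: char_neq2; rewrite inE. Qed.

(** The duplication formula relative to the root -A. The square root is explicit because its
    vanishing, when x(2 Q) = -A, is used as well. *)
Lemma double_square (A B C : K) Q x' y' :
  on_curve (cubic_curve A B C) Q ->
  ec_add (cubic_curve A B C) Q Q = Some (x', y') ->
  exists x y, [/\ Q = Some (x, y), y != 0 &
    x' + A = (((x + A) ^+ 2 - (B - A) * (C - A)) / (2%:R * y)) ^+ 2].
Proof.
case: Q => [[x y]|] //= e; rewrite eqxx /= !(mul0r, subr0, addr0) in e *.
have {}e : y ^+ 2 = (x + A) * (x + B) * (x + C) by rewrite e; ring.
have [//|ny] := eqVneq y (- y) => -[<- _].
have y0 : y != 0 by apply: contra ny => /eqP ->; rewrite oppr0.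
exists x, y; split=> //; set D := 2%:R * y; set M := 3%:R * _ + _ + _.
have D0 : D != 0 by rewrite mulf_neq0.
have D2 : D ^+ 2 = 4%:R * ((x + A) * (x + B) * (x + C)) by rewrite exprMn e; ring.
(* Once [D ^+ 2] in the numerator is replaced by 4 f(x), that numerator is a perfect square. *)
transitivity ((M ^+ 2 - (B + C + x + x) * D ^+ 2) / D ^+ 2); first by field.
by rewrite expr_div_n D2 /M; congr (_ / _); ring.
Qed.

(** For x0 = r1^2, the ri are square roots of x0, x0 + A and x0 + B. The tangent at [P] has slope r1
    + r2 + r3, and the nonzero sums keep the ordinate of [P] nonzero. *)
Lemma half_point (A B r1 r2 r3 : K) :
    A = r2 ^+ 2 - r1 ^+ 2 -> B = r3 ^+ 2 - r1 ^+ 2 ->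
    r1 + r2 != 0 -> r1 + r3 != 0 -> r2 + r3 != 0 ->
  let P := Some (r1 ^+ 2 + r1 * r2 + r1 * r3 + r2 * r3,
                 (r1 + r2) * (r1 + r3) * (r2 + r3)) in
  on_curve (cubic_curve A B 0) P /\
  ec_add (cubic_curve A B 0) P P = Some (r1 ^+ 2, r1 * r2 * r3).
Proof.
move=> -> -> r12 r13 r23 /=; split; first by ring.
rewrite eqxx /= !(mul0r, subr0, addr0, mulr0).
set y := (r1 + r2) * _ * _.
have y0 : y != 0 by rewrite !mulf_neq0.
have ny : (y == - y) = false.
  by apply/negbTE; rewrite -addr_eq0 -mulr2n -mulr_natl mulf_neq0.
rewrite ny; set l := _ / _.
have -> : l = r1 + r2 + r3.
  apply: (mulIf (mulf_neq0 two_neq0 y0)).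
  by rewrite divfK ?mulf_neq0 // /y; ring.
by congr (Some (_, _)); rewrite /y; ring.
Qed.

End Halving.

(** * Explicit points of orders 8 and 4 *)

Section QuarticSubgroup.
Variables (K : fieldType) (char_neq2 : 2%N \notin [pchar K]) (a s t i : K).
Hypotheses (s2 : s ^+ 2 = 1 + a ^+ 2) (t2 : t ^+ 2 = 1 - a ^+ 2) (i2 : i ^+ 2 = -1).
Hypotheses (a0 : a != 0) (s0 : s != 0) (t0 : t != 0).

Let two_neq0 : 2%:R != 0 :> K.
Proof. by move: char_neq2; rewrite inE. Qed.

Local Notation W := (cubic_curve (a ^+ 4) 1 0).

(** The discriminant is 16 times the squared product of the differences of 0, -1, -a^4, and 1 - a^4
    = (s t)^2. *)
Lemma elliptic_quartic : elliptic W.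
Proof.
rewrite /elliptic; have -> : discriminant W = (4%:R * a ^+ 4 * (s * t) ^+ 2) ^+ 2.
  rewrite [(s * t) ^+ 2]exprMn s2 t2 /discriminant /b2 /b4 /b6 /b8 /=; ring.
by rewrite expf_neq0 // !mulf_neq0 ?expf_neq0 // -[4%N]/(2 * 2)%N natrM mulf_neq0.
Qed.

Let neq0_of_sqr (x y : K) : x ^+ 2 - y ^+ 2 != 0 -> x + y != 0.
Proof. by rewrite subr_sqr mulf_eq0 negb_or => /andP[]. Qed.

(** Three halvings, with (r1, r2, r3) as follows: (0, a^2, 1) halves (0, 0) into [Q], (a, a s, s)
    halves [Q] into [R], and (i, i t s, 0) halves (-1, 0) into [S]. *)
Lemma has_subgroup_quartic : has_subgroup_iso_to ('Z_8 * 'Z_4)%type W.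
Proof.
have i0 : i != 0 by rewrite -sqrf_eq0 i2 oppr_eq0 oner_neq0.
have s1 : 1 + s != 0.
  by rewrite addrC; apply: neq0_of_sqr; rewrite s2 expr1n addrC addKr expf_neq0.
have a1 : 1 + a != 0 by apply: neq0_of_sqr; rewrite expr1n -t2 expf_neq0.
have as0 : a + s != 0.
  by rewrite addrC; apply: neq0_of_sqr; rewrite s2 addrK oner_neq0.
have ts1 : 1 + t * s != 0.
  apply: neq0_of_sqr; rewrite exprMn s2 t2.
  by have -> : 1 ^+ 2 - (1 - a ^+ 2) * (1 + a ^+ 2) = a ^+ 4; [ring|rewrite expf_neq0].
have eA1 : a ^+ 4 = (a * s) ^+ 2 - a ^+ 2 by rewrite exprMn s2; ring.
have eB1 : 1 = s ^+ 2 - a ^+ 2 by rewrite s2 addrK.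
have eA2 : a ^+ 4 = (a ^+ 2) ^+ 2 - 0 ^+ 2 by ring.
have eB2 : 1 = 1 ^+ 2 - 0 ^+ 2 :> K by ring.
have eA3 : a ^+ 4 = (i * t * s) ^+ 2 - i ^+ 2 by rewrite !exprMn i2 t2 s2; ring.
have eB3 : 1 = 0 ^+ 2 - i ^+ 2 by rewrite i2; ring.
have [||| cR RR] := half_point char_neq2 eA1 eB1.
- by rewrite -{1}[a]mulr1 -mulrDr mulf_neq0.
- exact: as0.
- by rewrite -{2}[s]mul1r -mulrDl addrC mulf_neq0.
have [||| cQ QQ] := half_point char_neq2 eA2 eB2.
- by rewrite add0r expf_neq0.
- by rewrite add0r oner_neq0.
- by rewrite addrC -s2 expf_neq0.
have [||| cS SS] := half_point char_neq2 eA3 eB3.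
- by rewrite -{1}[i]mulr1 -mulrA -mulrDr mulf_neq0.
- by rewrite addr0.
- by rewrite addr0 !mulf_neq0.
move: cR RR; set R := Some (_ + a * s * s, _) => cR; rewrite -/R.
(* The double of [R] is put in the shape that [half_point] gives to [Q]. *)
have -> : Some (a ^+ 2, a * (a * s) * s) = Some (0 ^+ 2 + 0 * a ^+ 2 + 0 * 1 + a ^+ 2 * 1,
    (0 + a ^+ 2) * (0 + 1) * (a ^+ 2 + 1)).
  by congr (Some (_, _)); [|transitivity (a ^+ 2 * s ^+ 2); [|rewrite s2]]; ring.
move: cQ QQ; set Q := Some (0 ^+ 2 + _ + _ + _, _) => cQ QQ RR.
move: cS SS; set S := Some (_ + i * t * s * 0, _) => cS SS.
have {}QQ : ec_add W Q Q = Some (0, 0) by rewrite QQ expr0n /= !mul0r.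
have {}SS : ec_add W S S = Some (-1, 0) by rewrite SS i2 mulr0.
pose e := elliptic_quartic.
pose gR : ec_group char_neq2 e := ec_of _ _ cR.
pose gS : ec_group char_neq2 e := ec_of _ _ cS.
have vR4 : val (gR *+ 4) = Some (0, 0).
  by rewrite -[4%N]/(2 * 2)%N mulrnA !mulr2n !val_ec_add -[val gR]/R RR QQ.
have vS2 : val (gS *+ 2) = Some (-1, 0) by rewrite mulr2n val_ec_add -[val gS]/S SS.
have order2 (P : ec_group char_neq2 e) x : val P = Some (x, 0) -> P *+ 2 = 0.
  move=> vP; apply: val_inj; rewrite mulr2n val_ec_add vP /= eqxx.
  by rewrite mul0r !subr0 oppr0 eqxx.
have R8 : gR *+ 8 = 0 by rewrite (mulrnA gR 4 2) (order2 _ _ vR4).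
have S4 : gS *+ 4 = 0 by rewrite (mulrnA gS 2 2) (order2 _ _ vS2).
apply: (has_subgroup_of_additive (z8z4_mapD R8 S4)).
apply: z8z4_map_inj => //.
- by apply/eqP=> /(congr1 val); rewrite vR4.
- by apply/eqP=> /(congr1 val); rewrite vS2.
- apply/eqP=> /(congr1 val); rewrite vR4 vS2 => -[/eqP].
  by rewrite eq_sym oppr_eq0 oner_eq0.
Qed.
End QuarticSubgroup.

(** * The curves E4 *)

Section Excluded.
Variables (K : fieldType) (char_neq2 : 2%N \notin [pchar K]).

Let two_neq0 : 2%:R != 0 :> K.
Proof. by move: char_neq2; rewrite inE. Qed.

(** From (c - a)^2 = 1 + a^2: a = 0 gives c = 1 or -1, a^2 = 1 gives c - a a square root of 2, and
    a^2 = -1 gives c = a. The case c = 0 falls under a = 0 because [0^-1] is 0. The right side says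
    that two roots of [E4 c] collide. *)
Lemma excludedP (c : K) (a := (c - c^-1) / 2%:R) :
  excluded c <-> a = 0 \/ a ^+ 4 = 1.
Proof.
case: (eqVneq c 0) @a => [->|c0] a.
  by split=> _; [left; rewrite /a invr0 subr0 mul0r|apply: Or41].
have sqrt2 e r : r ^+ 2 = 2%:R -> e ^+ 2 = 1 -> c = e + r -> a ^+ 4 = 1.
  move=> r2 e1 ec; suff -> : a = e by rewrite (exprM e 2 2) e1 expr1n.
  apply: (mulIf (mulf_neq0 two_neq0 c0)); rewrite /a.
  have -> : (c - c^-1) / 2%:R * (2%:R * c) = c ^+ 2 - 1 by field; rewrite c0 two_neq0.
  rewrite ec; transitivity (e ^+ 2 + 2%:R * e * r + r ^+ 2 - 1); first by ring.
  by rewrite r2 e1; transitivity (2%:R * e ^+ 2 + 2%:R * e * r); [rewrite e1|]; ring.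
split.
  case=> [/eqP|[]ec|[r [r2 [] ec]]|ec].
  - by rewrite (negPf c0).
  - by left; rewrite /a ec invr1 subrr mul0r.
  - by left; rewrite /a ec invrN1 subrr mul0r.
  - by right; apply: (sqrt2 1 r); rewrite ?expr1n.
  - by right; apply: (sqrt2 1 (- r)); rewrite ?expr1n ?sqrrN.
  - by right; apply: (sqrt2 (- 1) r); rewrite ?sqrrN ?expr1n.
  - by right; apply: (sqrt2 (- 1) (- r)); rewrite ?sqrrN ?expr1n.
  right; have -> : a = (c ^+ 2 - 1) / (2%:R * c).
    by rewrite /a; field; rewrite c0 two_neq0.
  rewrite ec (_ : (-1 - 1) / _ = - c^-1); last by field; rewrite c0 two_neq0.
  by rewrite (exprM _ 2 2) sqrrN exprVn ec invrN1 sqrrN expr1n.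
have ca : c ^+ 2 = 1 + 2%:R * a * c by rewrite /a; field; rewrite c0 two_neq0.
case=> [a0|/eqP].
  move/eqP: ca; rewrite a0 mulr0 mul0r addr0 sqrf_eq1.
  by case/orP=> /eqP ->; apply: Or42; [left|right].
have sqrt2' : a ^+ 2 = 1 -> (c - a) ^+ 2 = 2%:R.
  by move=> a2; transitivity (c ^+ 2 - 2%:R * a * c + a ^+ 2); [|rewrite ca a2]; ring.
rewrite (exprM a 2 2) sqrf_eq1 => /orP[/eqP a2|/eqP a2].
  apply: Or43; exists (c - a); split; first exact: sqrt2'.
  by move/eqP: a2; rewrite sqrf_eq1 => /orP[]/eqP ->; [apply: Or41|apply: Or43]; ring.
apply: Or44; have /eqP : (c - a) ^+ 2 = 0.
  by transitivity (c ^+ 2 - 2%:R * a * c + a ^+ 2); [|rewrite ca a2]; ring.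
by rewrite sqrf_eq0 subr_eq0 => /eqP ->.
Qed.

End Excluded.

(** * From a subgroup to the parameters c and d *)

Section Parametrization.
Variables (K : fieldType) (char_neq2 : 2%N \notin [pchar K]).

Let two_neq0 : 2%:R != 0 :> K.
Proof. by move: char_neq2; rewrite inE. Qed.

(** Completing the square in y. *)
Lemma isomorphic_short (E : weierstrass K) :
  exists a2 a4 a6, isomorphic E (Weierstrass 0 a2 0 a4 a6).
Proof.
case: E => a1 a2 a3 a4 a6.
pose W := change_variables 1 0 (- a1 / 2%:R) (- a3 / 2%:R) (Weierstrass a1 a2 a3 a4 a6).
exists (wa2 W), (wa4 W), (wa6 W), 1, 0, (- a1 / 2%:R), (- a3 / 2%:R).
by rewrite oner_neq0; split=> //; congr Weierstrass; field; rewrite oner_neq0 two_neq0.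
Qed.

(** Successive divided differences of the three equations determine [a6], [a4] and [a2]. *)
Lemma cubic_curve_of_roots (a2 a4 a6 e1 e2 e3 : K) :
    e1 != e2 -> e1 != e3 -> e2 != e3 ->
    (forall e, e \in [:: e1; e2; e3] ->
       on_curve (Weierstrass 0 a2 0 a4 a6) (Some (e, 0))) ->
  Weierstrass 0 a2 0 a4 a6 = cubic_curve (- e1) (- e2) (- e3).
Proof.
move=> n12 n13 n23 h.
have root e : e \in [:: e1; e2; e3] -> a6 = - (e ^+ 3 + a2 * e ^+ 2 + a4 * e).
  move/h=> /=; rewrite expr0n /= !mul0r !addr0 => h'.
  by apply/eqP; rewrite -addr_eq0 addrC -h'.
have r1 := root e1 (mem_head _ _).
have r2 := root e2 (mem_nth 0 (isT : (1 < size [:: e1; e2; e3])%N)).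
have r3 := root e3 (mem_nth 0 (isT : (2 < size [:: e1; e2; e3])%N)).
have s2 e : e1 != e -> a6 = - (e ^+ 3 + a2 * e ^+ 2 + a4 * e) ->
    a4 = - (e1 ^+ 2 + e1 * e + e ^+ 2 + a2 * (e1 + e)).
  move=> ne re; apply: (mulIf (_ : e1 - e != 0)); first by rewrite subr_eq0.
  apply/eqP; rewrite -subr_eq0; apply/eqP.
  transitivity (- (e ^+ 3 + a2 * e ^+ 2 + a4 * e) + (e1 ^+ 3 + a2 * e1 ^+ 2 + a4 * e1)).
    by ring.
  by rewrite -re r1; ring.
have ea2 : a2 = - e1 - e2 - e3.
  apply: (mulIf (_ : e2 - e3 != 0)); first by rewrite subr_eq0.
  apply/eqP; rewrite -subr_eq0; apply/eqP.
  transitivity (- (e1 ^+ 2 + e1 * e3 + e3 ^+ 2 + a2 * (e1 + e3))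
     + (e1 ^+ 2 + e1 * e2 + e2 ^+ 2 + a2 * (e1 + e2))); first by ring.
  by rewrite -(s2 _ n13 r3) [X in X + _](s2 _ n12 r2); ring.
by rewrite /cubic_curve r1 (s2 _ n12 r2) ea2; congr Weierstrass; ring.
Qed.

(** For generators R and S of orders 8 and 4, the ei are the abscissas of 4 R, 2 S and 4 R + 2 S,
    while m^2 and n^2 are x(2 R) - e1 and x(2 R) - e2. *)
Lemma has_subgroup_roots (a2 a4 a6 : K) :
  has_subgroup_iso_to ('Z_8 * 'Z_4)%type (Weierstrass 0 a2 0 a4 a6) ->
  exists e1 e2 e3 q m n k w : K,
    [/\ [/\ e1 != e2, e1 != e3 & e2 != e3],
        Weierstrass 0 a2 0 a4 a6 = cubic_curve (- e1) (- e2) (- e3),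
        [/\ q ^+ 2 = e1 - e2, k ^+ 2 = e2 - e1 & w ^+ 2 = e2 - e3],
        q != 0 &
        (m ^+ 2) ^+ 2 = (e1 - e2) * (e1 - e3) /\ n ^+ 2 = m ^+ 2 + q ^+ 2].
Proof.
case=> H [[Hon H0 _ _] [phi [phiD phi_inj Hphi]]].
set W := Weierstrass _ _ _ _ _ in Hon phiD *.
have con g : on_curve W (phi g) by apply/Hon/Hphi; exists g.
have phi0 : phi 0 = None.
  have [g gN] := (Hphi None).1 H0.
  by have := phiD g 0; rewrite addr0 gN.
have dbl g : ec_add W (phi g) (phi g) = phi (g + g) by rewrite phiD.
have tors g : g + g = 0 -> g != 0 -> exists e, phi g = Some (e, 0).
  move=> gg g0; have := dbl g; rewrite gg phi0; have := con g.
  case E : (phi g) => [[x y]|] c.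
    case: (ec_addP char_neq2 c c) => // _ ey _; exists x; congr (Some (_, _)).
    by apply/eqP; rewrite -(mulrI_eq0 _ (mulfI two_neq0)) mulr_natl mulr2n {1}ey addNr.
  by case/eqP: g0; apply: phi_inj; rewrite phi0.
pose r : 'Z_8 * 'Z_4 := (1, 0); pose s : 'Z_8 * 'Z_4 := (0, 1).
pose g1 := r + r + (r + r); pose g2 := s + s.
have [e1 E1] : exists e, phi g1 = Some (e, 0) by apply: tors => //; apply/eqP.
have [e2 E2] : exists e, phi g2 = Some (e, 0) by apply: tors => //; apply/eqP.
have [e3 E3] : exists e, phi (g1 + g2) = Some (e, 0) by apply: tors => //; apply/eqP.
have neq g h e e' : phi g = Some (e, 0) -> phi h = Some (e', 0) -> g != h -> e != e'.
  by move=> Eg Eh; apply: contra => /eqP ee; apply/eqP/phi_inj; rewrite Eg Eh ee.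
have n12 : e1 != e2 by apply: neq E1 E2 _.
have n13 : e1 != e3 by apply: neq E1 E3 _.
have n23 : e2 != e3 by apply: neq E2 E3 _.
have eW : W = cubic_curve (- e1) (- e2) (- e3).
  apply: cubic_curve_of_roots => // e; rewrite !inE.
  by case/or3P=> /eqP ->; rewrite -?E1 -?E2 -?E3.
(* The roots are permuted so that [double_square] applies to each of them. *)
have eW2 : W = cubic_curve (- e2) (- e1) (- e3).
  by rewrite eW /cubic_curve; congr Weierstrass; ring.
have eW3 : W = cubic_curve (- e3) (- e1) (- e2).
  by rewrite eW /cubic_curve; congr Weierstrass; ring.
have sq h x' y' A B C : W = cubic_curve A B C -> phi (h + h) = Some (x', y') ->
    exists x y, [/\ phi h = Some (x, y), y != 0 &
      x' + A = (((x + A) ^+ 2 - (B - A) * (C - A)) / (2%:R * y)) ^+ 2].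
  by move=> e; rewrite -dbl e; apply: double_square => //; rewrite -e; apply: con.
have [xQ [yQ [EQ yQ0 eQ]]] := sq (r + r) _ _ _ _ _ eW E1.
have [x0 [y0 [_ _ e12]]] := sq (r + r) _ _ _ _ _ eW2 E1.
have [x1 [y1 [_ _ eR1]]] := sq r _ _ _ _ _ eW EQ.
have [x2 [y2 [_ _ eR2]]] := sq r _ _ _ _ _ eW2 EQ.
have [x3 [y3 [_ _ e21]]] := sq s _ _ _ _ _ eW E2.
have [x4 [y4 [_ _ e23]]] := sq s _ _ _ _ _ eW3 E2.
move: e12 eR1 eR2 e21 e23.
move: (_ / _) (_ / _) (_ / _) (_ / _) (_ / _) => w k n m q e12 eR1 eR2 e21 e23.
exists e1, e2, e3, q, m, n, k, w; split=> //.
  by rewrite -sqrf_eq0 -e12 subr_eq0.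
rewrite -eR1 -eR2 -e12; split; last by ring.
(* Since 4 R has abscissa e1, its square root relative to e1 is 0, so (x(2 R) - e1)^2 = (e1 - e2)(e1
   - e3). *)
move/eqP: eQ; rewrite subrr eq_sym sqrf_eq0 mulf_eq0 invr_eq0.
rewrite mulf_eq0 (negPf two_neq0) (negPf yQ0) !orbF subr_eq0 => /eqP ->.
by ring.
Qed.

Lemma has_subgroup_E4 (W : weierstrass K) :
  has_subgroup_iso_to ('Z_8 * 'Z_4)%type W ->
  exists i, i ^+ 2 = -1 /\ exists c d : K,
    [/\ ~ excluded c, ~ excluded d, c - c^-1 = i * (d - d^-1) & isomorphic W (E4 c)].
Proof.
have [a2 [a4 [a6 iso]]] := isomorphic_short W.
move/(has_subgroup_isomorphic iso)/has_subgroup_roots.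
case=> e1 [e2 [e3 [q [m [n [k [w]]]]]]].
case=> [[n12 n13 n23] eW [q2 k2 w2] q0 [m4 n2]].
rewrite {}eW in iso.
have e2E : e2 = e1 - q ^+ 2 by rewrite q2; ring.
have k2' : k ^+ 2 = - q ^+ 2 by rewrite k2 q2; ring.
have [i i2] : exists i : K, i ^+ 2 = -1.
  by exists (k / q); rewrite expr_div_n k2' mulNr divff ?expf_neq0.
(* Translating by e1 and scaling by q will turn the roots into 0, -1 and -a^4. *)
have [a aE] : exists a, a = m / q by exists (m / q).
have [s s2] : exists s, s ^+ 2 = 1 + a ^+ 2.
  by exists (n / q); rewrite aE !expr_div_n n2; field.
have a4E : a ^+ 4 * q ^+ 2 = e1 - e3.
  by apply: (mulfI (expf_neq0 2 q0)); rewrite {3}q2 -m4 aE; field.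
have e3E : e3 = e1 - a ^+ 4 * q ^+ 2 by rewrite a4E; ring.
have a0 : a != 0.
  by apply: contra n13 => /eqP a0; rewrite e3E a0 expr0n /= mul0r subr0.
have a41 : a ^+ 4 != 1.
  by apply: contra n23 => /eqP a1; rewrite e3E e2E a1 mul1r.
have s0 : s != 0.
  apply: contra a41 => /eqP s0; have a2' : a ^+ 2 = -1.
    by rewrite -[LHS](addKr 1) -s2 s0 expr0n /= addr0.
  by rewrite (exprM a 2 2) a2' sqrrN expr1n.
have [t t2] : exists t, t ^+ 2 = 1 - a ^+ 2.
  (* w^2 = e2 - e3 = q^2 (a^4 - 1), so (i w / q)^2 = 1 - a^4 = s^2 (1 - a^2). *)
  exists (i * w / (q * s)); rewrite expr_div_n.
  apply: (canLR (mulfK (expf_neq0 2 (mulf_neq0 q0 s0)))).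
  by rewrite !exprMn i2 w2 s2 e2E e3E; ring.
(* [b] is a / i, so b^2 = -a^2 and b^4 = a^4: [d] arises from (b, t) as [c] does from (a, s), and is
   excluded under the same condition on a. *)
pose c := a + s; pose b := - i * a; pose d := b + t.
have b2 : b ^+ 2 = - a ^+ 2 by rewrite exprMn sqrrN i2 mulN1r.
have inv_of (x y : K) : y ^+ 2 = 1 + x ^+ 2 -> (x + y)^-1 = y - x.
  move=> e; have xy1 : (y - x) * (x + y) = 1 by rewrite (addrC x) -subr_sqr e addrK.
  have xy0 : x + y != 0.
    apply/eqP=> xy0; move: xy1; rewrite xy0 mulr0 => /esym/eqP.
    by rewrite oner_eq0.
  by apply: (mulIf xy0); rewrite mulVf.
have ec : c - c^-1 = 2%:R * a by rewrite /c inv_of //; ring.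
have ed : d - d^-1 = 2%:R * b by rewrite /d inv_of ?t2 ?b2 //; ring.
exists i; split=> //; exists c, d; split.
- by case/(excludedP char_neq2); rewrite ec mulrC mulKf // => /eqP; apply/negP.
- case/(excludedP char_neq2); rewrite ed mulrC mulKf // => /eqP; apply/negP.
    by rewrite -sqrf_eq0 b2 oppr_eq0 sqrf_eq0.
  by rewrite (exprM b 2 2) b2 sqrrN -exprM.
- by rewrite ec ed /b; transitivity (- (2%:R * i ^+ 2 * a)); [rewrite i2|]; ring.
apply: isomorphic_trans iso _; exists q, e1, 0, 0; split=> //.
rewrite /E4 ec (mulrC 2%:R) mulfK // /cubic_curve /= e2E e3E.
by congr Weierstrass; field.
Qed.

End Parametrization.

Theorem theorem6p11 (K : fieldType) (char_neq2 : 2%N \notin [pchar K])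
    (E : weierstrass K) (ellE : elliptic E) :
  has_subgroup_iso_to ('Z_8 * 'Z_4)%type E
  <->
  exists i : K, i ^+ 2 = -1 /\
    exists c d : K,
      [/\ ~ excluded c, ~ excluded d,
          c - c^-1 = i * (d - d^-1)
        & isomorphic E (E4 c)].
Proof.
split; first exact: has_subgroup_E4.
case=> i [i2 [c [d [nc nd ecd iso]]]].
apply: (has_subgroup_isomorphic (isomorphic_sym iso)).
have two_neq0 : 2%:R != 0 :> K by move: char_neq2; rewrite inE.
have c0 : c != 0 by apply/eqP=> c0; apply: nc; apply: Or41.
have d0 : d != 0 by apply/eqP=> d0; apply: nd; apply: Or41.
rewrite /E4; set a := (c - c^-1) / 2%:R.
have a0 : a != 0 by apply/eqP => a0; apply: nc; apply/excludedP => //; left.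
have a41 : 1 - a ^+ 4 != 0.
  by rewrite subr_eq0 eq_sym; apply/eqP=> a1; apply: nc; apply/excludedP => //; right.
(* The parametrization inverted: c = a + s and c^-1 = s - a give s as half of c + c^-1, and likewise
   t from d. *)
have s2 : ((c + c^-1) / 2%:R) ^+ 2 = 1 + a ^+ 2 by rewrite /a; field; rewrite c0 two_neq0.
have t2 : ((d + d^-1) / 2%:R) ^+ 2 = 1 - a ^+ 2.
  transitivity (1 + ((d - d^-1) / 2%:R) ^+ 2); first by field; rewrite d0 two_neq0.
  by rewrite /a ecd -mulrA [(i * _) ^+ 2]exprMn i2 mulN1r opprK.
(* As 1 - a^4 is the product of s^2 and t^2, neither s nor t is 0. *)
have := a41; have -> : 1 - a ^+ 4 = (1 + a ^+ 2) * (1 - a ^+ 2) by ring.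
rewrite -s2 -t2 mulf_eq0 !sqrf_eq0 negb_or => /andP[s0 t0].
exact: (has_subgroup_quartic char_neq2 s2 t2 i2).
Qed.
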